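(* Let $k$ be a positive integer, let $G(x)=\sum_{a=1}^k x^a$, let $\phi$ be the unique positive real number with $\sum_{a=1}^k\phi^{-a}=1$, and let $\sigma=1/\phi$. For $n\ge 0$ let $T_n$ be the total number of parts among all compositions of $n$ whose parts all lie in $\{1,\ldots,k\}$. Then there is a constant $A$ with $0<A<1$ such that \[ T_n=\frac{\phi^{n+2}}{G'(\sigma)^2}(n+1)+\frac{\phi^{n+1}G''(\sigma)}{G'(\sigma)^3}-\frac{\phi^{n+1}}{G'(\sigma)}+O(A^n). \]
   Context: A composition of a nonnegative integer $n$ is a finite sequence of positive integers summing to $n$; its entries are its parts ($0$ has only the empty composition). $G'$, $G''$ are derivatives of $G$. $f(n)=h(n)+O(A^n)$ means there exist $C,N>0$ with $|f(n)-h(n)|\le C A^n$ for all $n>N$. *)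

(* Defs.v *)
From HB Require Import structures.
From mathcomp Require Import all_boot all_order all_algebra.
From mathcomp Require Import boolp classical_sets cardinality fsbigop reals.

Set Implicit Arguments.
Unset Strict Implicit.
Unset Printing Implicit Defensive.

Import Order.TTheory GRing.Theory Num.Theory.

Local Open Scope ring_scope.

Definition is_composition (n : nat) (s : seq nat) : bool :=
  all (fun a => 0 < a)%N s && (sumn s == n).

Definition bounded_compositions (k n : nat) : set (seq nat) :=
  [set s | is_composition n s /\ all (fun a => a \in iota 1 k) s]%classic.

(* [\sum_(s \in A)] is 0 by convention when infinitely many terms are nonzero;
   this lemma shows that the convention is never used in [total_parts]. *)
Lemma finite_bounded_compositions (k n : nat) :
  finite_set (bounded_compositions k n).
Proof.
pose F (t : n.-bseq 'I_k.+1) : seq nat := map val t.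
apply: (@sub_finite_set _ _ (F @` [set: n.-bseq 'I_k.+1])%classic); last first.
  by apply: finite_image; exact: finite_finset.
move=> s [/andP[s_gt0 /eqP sum_s] s_le].
have size_s : (size (map (@inord k) s) <= n)%N.
  rewrite size_map -sum_s; elim: s s_gt0 {sum_s s_le} => //= a s IHs.
  by case/andP=> a_gt0 /IHs; rewrite -add1n; exact: leq_add.
exists (Bseq size_s) => //; rewrite /F /= -map_comp.
rewrite -[RHS]map_id; apply/eq_in_map => a /(allP s_le) /=.
by rewrite mem_iota add1n => /andP[_ a_le]; rewrite inordK.
Qed.

Definition total_parts (k n : nat) : nat :=
  (\sum_(s \in bounded_compositions k n) size s)%N.

Definition Gpoly (R : realType) (k : nat) : {poly R} :=
  \sum_(1 <= a < k.+1) 'X^a.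

(* f(n) = h(n) + O(A^n) *)
Definition eq_upto_bigO_exp (R : realType) (f h : nat -> R) (A : R) : Prop :=
  exists (C : R) (N : nat), [/\ 0 < C, (0 < N)%N &
    forall n : nat, (N < n)%N -> `|f n - h n| <= C * A ^+ n].

(* Main.v *)
(** The generating function of [T_n] is [sum_m m G^m = G / (1 - G)^2]. Write
    [1 - G = (1 - phi X) Q]. Splitting off the double pole at [sigma] gives the
    main term, with remainder [S / Q^2] for a polynomial [S], so the point is
    that [1 / Q] has radius of convergence larger than 1. As in the
    Enestrom-Kakeya theorem, the coefficients of [Q] are positive and decrease
    by a factor at most [theta < 1] at each step, so [(1 - theta X) Q = 1 - V]
    with [V] nonnegative. For [theta < A < 1] this gives [V(1/A) < 1], hence
    the geometric series [1 / (1 - V)] converges at [1/A] and no complex root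
    has to be located. Power series are handled as polynomials modulo ['X^N]. *)
Require Import Defs.
From mathcomp Require Import all_boot all_order all_algebra.
From mathcomp Require Import classical_sets fsbigop reals.
From mathcomp Require Import ring lra.

Set Implicit Arguments.
Unset Strict Implicit.
Unset Printing Implicit Defensive.

Import Order.TTheory GRing.Theory Num.Theory.

Local Open Scope ring_scope.

(** * Compositions with [m] parts and powers of [G] *)

(** The filter guards the truncated subtraction: for [a > n], [n - a] would be 0 and sequences of
    too large a sum would appear. *)
Fixpoint comp_seq (k m n : nat) : seq (seq nat) :=
  if m is m'.+1 then
    [seq a :: s | a <- [seq a <- iota 1 k | (a <= n)%N],
                  s <- comp_seq k m' (n - a)]
  else nseq (n == 0%N) [::].

Lemma mem_comp_seq (k m n : nat) (s : seq nat) :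
  (s \in comp_seq k m n) =
  [&& size s == m, sumn s == n & all (fun a => a \in iota 1 k) s].
Proof.
elim: m n s => [|m IHm] n s /=.
  by rewrite mem_nseq; case: n s => [|n] [|a s].
apply/allpairsPdep/idP => [[a [t [+ + ->]]]|].
  rewrite mem_filter IHm /= => /andP[le_an ka] /and3P[/eqP-> /eqP-> ->].
  by rewrite /= ka subnKC // !eqxx.
case: s => [//|a s] /= /and3P[size_s /eqP sum_s /andP[ka ks]].
exists a, s; split=> //.
  by rewrite mem_filter ka -sum_s leq_addr.
by rewrite IHm -eqSS size_s -sum_s addKn eqxx.
Qed.

Lemma uniq_comp_seq (k m n : nat) : uniq (comp_seq k m n).
Proof.
elim: m n => [|m IHm] n /=; first by case: eqP.
apply: allpairs_uniq_dep => [|a _|[a s] [b t] _ _ /= [-> ->] //].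
- by rewrite filter_uniq // iota_uniq.
- exact: IHm.
Qed.

(** Choosing the first part [a] amounts to choosing the term ['X^a] in one factor of [G^m]. *)
Lemma size_comp_seq (R : realType) (k m n : nat) :
  (size (comp_seq k m n))%:R = (Gpoly R k ^+ m)`_n.
Proof.
elim: m n => [|m IHm] n; first by rewrite expr0 coef1 size_nseq.
rewrite exprS {1}/Gpoly mulr_suml coef_sum /= size_allpairs_dep sumnE big_map.
rewrite big_filter natr_sum /index_iota subn1 big_mkcond /=.
by apply: eq_bigr => a _; rewrite IHm coefXnM leqNgt; case: ltnP.
Qed.

Lemma total_partsE (k n : nat) :
  total_parts k n = (\sum_(m < n.+1) m * size (comp_seq k m n))%N.
Proof.
pose r := [seq s | m <- iota 0 n.+1, s <- comp_seq k m n].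
(* The blocks are disjoint because the length of a sequence determines its [m]; [m <= n] suffices
   because parts are positive. *)
have uniq_r : uniq r.
  apply: allpairs_uniq_dep => [|m _|]; [exact: iota_uniq|exact: uniq_comp_seq|].
  move=> [a s] [b t] /allpairsPdep[a' [s' [_ + [-> ->]]]].
  move=> + /allpairsPdep[b' [t' [_ + [-> ->]]]] /= eq_st.
  by rewrite !mem_comp_seq eq_st => /andP[/eqP-> _] /andP[/eqP-> _].
have def_r : bounded_compositions k n = [set` r]%classic.
  apply/seteqP; split => s /=.
    move=> [/andP[s_gt0 sum_s] s_le]; apply/allpairsPdep; exists (size s), s.
    split=> //; last by rewrite mem_comp_seq eqxx sum_s.
    rewrite mem_iota ltnS /= -(eqP sum_s).
    elim: s s_gt0 {sum_s s_le} => //= a s IHs /andP[a_gt0 /IHs].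
    by rewrite -add1n; exact: leq_add.
  case/allpairsPdep=> m [t [_ + ->]]; rewrite mem_comp_seq.
  move=> /and3P[_ sum_t t_le].
  split=> //; rewrite /is_composition sum_t andbT.
  by apply: sub_all t_le => a; rewrite mem_iota => /andP[].
rewrite /total_parts def_r -fsbig_seq // big_allpairs_dep /=.
rewrite -(big_mkord xpredT (fun m => m * size (comp_seq k m n))%N).
rewrite /index_iota subn0.
apply: eq_bigr => m _; rewrite -sum1_size big_distrr /=.
by apply: eq_big_seq => t; rewrite mem_comp_seq muln1 => /andP[/eqP].
Qed.

(** * Truncated power series and the generating function of [total_parts] *)

Lemma coef_of_dvdXn (R : fieldType) (N i : nat) (p : {poly R}) :
  'X^N %| p -> (i < N)%N -> p`_i = 0.
Proof. by move=> /dvdpP[q ->] lt_iN; rewrite coefMXn lt_iN. Qed.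

Lemma dvdXn_of_coef (R : fieldType) (N : nat) (p : {poly R}) :
  (forall i, (i < N)%N -> p`_i = 0) -> 'X^N %| p.
Proof.
move=> p0; rewrite -(poly_take_drop N p) (_ : take_poly N p = 0).
  by rewrite add0r dvdp_mull.
by apply/polyP => i; rewrite coef_take_poly coef0; case: ifP => // /p0.
Qed.

(** Finite form of the expansion of [(1 - y)^-2], applied below both to [y = G] and to
    [y = phi X]. *)
Lemma sqr_geometric_sum (R : comNzRingType) (y : R) (N : nat) :
  (1 - y) ^+ 2 * (\sum_(m < N) m.+1%:R * y ^+ m) =
  1 - N.+1%:R * y ^+ N + N%:R * y ^+ N.+1.
Proof.
elim: N => [|N IHN]; first by rewrite big_ord0; ring.
by rewrite big_ord_recr mulrDr IHN /= !exprS -!natr1; ring.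
Qed.

Lemma coef_Gpoly (R : realType) (k n : nat) :
  (Gpoly R k)`_n = (0 < n <= k)%N%:R.
Proof.
rewrite /Gpoly coef_sum; under eq_bigr do rewrite coefXn.
have [n_in|n_notin] := boolP (n \in index_iota 1 k.+1).
  rewrite (bigD1_seq n) ?iota_uniq //= eqxx big1 ?addr0.
    by move: n_in; rewrite mem_index_iota ltnS => ->.
  by move=> a; rewrite eq_sym => /negPf->.
rewrite big1_seq => [|a /andP[_ a_in]].
  by move: n_notin; rewrite mem_index_iota ltnS => /negPf->.
by case: eqP a_in n_notin => // -> ->.
Qed.

Lemma total_parts_Gpoly (R : realType) (k n N : nat) : (n < N)%N ->
  (total_parts k n)%:R = (\sum_(m < N) m%:R * Gpoly R k ^+ m)`_n.
Proof.
move=> lt_nN; rewrite total_partsE natr_sum coef_sum.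
rewrite -(big_mkord xpredT (fun m => (m * size (comp_seq k m n))%:R)).
rewrite -(big_mkord xpredT (fun m => (m%:R * Gpoly R k ^+ m)`_n)).
(* Terms with [m > n] have no coefficient at [n], since ['X] divides [G]; so any truncation order
   above [n] gives the same value. *)
rewrite [RHS](big_cat_nat (n := n.+1)) //= [X in _ + X]big1_seq ?addr0;
  last first.
  move=> m /andP[_]; rewrite mem_index_iota => /andP[lt_nm _].
  have /dvdpP[q ->] : 'X^m %| Gpoly R k ^+ m.
    apply: dvdp_exp2r; rewrite -['X]expr1; apply: dvdXn_of_coef => -[] // _.
    by rewrite coef_Gpoly.
  by rewrite mulrA coefMXn lt_nm.
apply: eq_bigr => m _.
by rewrite natrM size_comp_seq -polyC_natr coefCM.
Qed.

(** * Nonnegative coefficients and exponential decay *)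

Lemma coefM_ge0 (R : realDomainType) (p q : {poly R}) :
  (forall i, 0 <= p`_i) -> (forall i, 0 <= q`_i) -> forall i, 0 <= (p * q)`_i.
Proof.
by move=> p_ge0 q_ge0 i; rewrite coefM sumr_ge0 // => j _; rewrite mulr_ge0.
Qed.

Lemma coef_exp_ge0 (R : realDomainType) (p : {poly R}) (m : nat) :
  (forall i, 0 <= p`_i) -> forall i, 0 <= (p ^+ m)`_i.
Proof.
move=> p_ge0; elim: m => [|m IHm] i; first by rewrite expr0 coef1 ler0n.
by rewrite exprS; exact: coefM_ge0.
Qed.

Lemma coefM_norm_le (R : realDomainType) (p q : {poly R}) (n : nat) :
  (forall i, 0 <= p`_i) ->
  `|(p * q)`_n| <= (p * map_poly Num.norm q)`_n.
Proof.
move=> p_ge0; rewrite !coefM.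
apply: le_trans (ler_norm_sum _ _ _) _; apply: ler_sum => i _.
by rewrite coef_map_id0 ?normr0 // normrM ger0_norm.
Qed.

Lemma horner_coef_ge0 (R : realDomainType) (p : {poly R}) (a : R) :
  (forall i, 0 <= p`_i) -> 0 <= a -> 0 <= p.[a].
Proof.
move=> p_ge0 a_ge0; rewrite horner_coef sumr_ge0 // => i _.
by rewrite mulr_ge0 ?exprn_ge0.
Qed.

(** Cauchy's estimate for nonnegative coefficients: a single term is at most the whole sum. *)
Lemma coef_le_horner (R : realDomainType) (p : {poly R}) (a : R) (n : nat) :
  (forall i, 0 <= p`_i) -> 0 <= a -> p`_n * a ^+ n <= p.[a].
Proof.
move=> p_ge0 a_ge0; have [lt_np|le_pn] := ltnP n (size p); last first.
  by rewrite nth_default // mul0r horner_coef_ge0.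
rewrite horner_coef (bigD1 (Ordinal lt_np)) //= lerDl sumr_ge0 // => i _.
by rewrite mulr_ge0 ?exprn_ge0.
Qed.

Lemma horner_geometric_le (R : realFieldType) (p : {poly R}) (a : R) (N : nat) :
  0 <= p.[a] < 1 -> (\sum_(m < N) p ^+ m).[a] <= (1 - p.[a])^-1.
Proof.
move=> /andP[p_ge0 p_lt1]; rewrite horner_sum.
under eq_bigr do rewrite horner_exp.
rewrite -[_^-1]mul1r ler_pdivlMr ?subr_gt0 // mulrC.
rewrite -opprB mulNr -subrX1 opprB gerBl; exact: exprn_ge0.
Qed.

(* If [(1 - V)^2 e = S] as power series, with [V] nonnegative, then
   [e = (\sum_m V^m)^2 S] and [V.[A^-1] < 1] makes the sum converge there. *)
Lemma coef_decay (R : realFieldType) (V S : {poly R}) (A : R) :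
  (forall i, 0 <= V`_i) -> V`_0 = 0 -> 0 < A -> V.[A^-1] < 1 ->
  exists2 C : R, 0 < C & forall (N n : nat) (E : {poly R}),
    'X^N %| (1 - V) ^+ 2 * E - S -> (n < N)%N -> `|E`_n| <= C * A ^+ n.
Proof.
move=> V_ge0 V0 A_gt0 VA_lt1; set a := A^-1.
have a_ge0 : 0 <= a by rewrite invr_ge0 ltW.
have normS_ge0 i : 0 <= (map_poly Num.norm S)`_i.
  by rewrite coef_map_id0 ?normr0.
(* Value at [a] of the majorant [|S| / (1 - V)^2], independent of [N]; the [+ 1] keeps it positive
   when [S = 0]. *)
exists ((1 - V.[a])^-1 ^+ 2 * (map_poly Num.norm S).[a] + 1).
  rewrite ltr_wpDl // mulr_ge0 //; last exact: horner_coef_ge0.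
  by rewrite exprn_ge0 // invr_ge0 subr_ge0 ltW.
move=> N n E VE lt_nN; pose B := \sum_(m < N) V ^+ m.
have B_ge0 i : 0 <= B`_i.
  by rewrite coef_sum sumr_ge0 // => m _; exact: coef_exp_ge0.
have BV : B * (1 - V) = 1 - V ^+ N by rewrite -opprB mulrN mulrC -subrX1 opprB.
have XV : 'X^N %| V ^+ N.
  by apply: dvdp_exp2r; rewrite -['X]expr1; apply: dvdXn_of_coef => -[].
(* [B] inverts [1 - V] modulo ['X^N], because [V] has no constant term. *)
have : 'X^N %| E - B ^+ 2 * S.
  have -> : E - B ^+ 2 * S =
      V ^+ N * ((2%:R - V ^+ N) * E) + B ^+ 2 * ((1 - V) ^+ 2 * E - S).
    rewrite mulrBr [B ^+ 2 * (_ * E)]mulrA -exprMn BV; ring.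
  by apply: dvdp_add; [exact: dvdp_mulr|exact: dvdp_mull].
move=> /coef_of_dvdXn/(_ lt_nN)/eqP; rewrite coefB subr_eq0 => /eqP->.
apply: (le_trans (coefM_norm_le _ _ _)); first exact: coef_exp_ge0.
rewrite -ler_pdivrMr ?exprn_gt0 // -exprVn -/a.
apply: (le_trans (coef_le_horner _ _ _)) => //.
  by apply: coefM_ge0 => //; exact: coef_exp_ge0.
rewrite hornerM horner_exp -[leLHS]addr0 lerD // ler_wpM2r ?horner_coef_ge0 //.
apply: lerXn2r; rewrite ?nnegrE ?horner_coef_ge0 //.
  by rewrite invr_ge0 subr_ge0 ltW.
by apply: horner_geometric_le; rewrite horner_coef_ge0.
Qed.

(** * The cofactor of [1 - phi X] in [1 - G] *)

(* Since [phi_root] reads [G.[sigma] = 1], the quotient of [1 - G] by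
   [1 - phi X] has coefficients [sigma + ... + sigma^(k - j)]. *)
Definition Gquo (R : realType) (k : nat) (phi : R) : {poly R} :=
  \poly_(j < k) \sum_(1 <= i < (k - j).+1) phi ^- i.

Lemma coef_Gquo (R : realType) (k : nat) (phi : R) (j : nat) :
  (Gquo k phi)`_j = \sum_(1 <= i < (k - j).+1) phi ^- i.
Proof.
rewrite coef_poly; case: ltnP => // le_kj.
by rewrite (eqP le_kj) big_geq.
Qed.

Lemma coef_GquoS (R : realType) (k : nat) (phi : R) (j : nat) : (j < k)%N ->
  (Gquo k phi)`_j = (Gquo k phi)`_j.+1 + phi ^- (k - j).
Proof.
move=> lt_jk; rewrite !coef_Gquo subnS.
by rewrite big_nat_recr /= ?subn_gt0 // prednK ?subn_gt0.
Qed.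

(** Peels off the first summand, where [coef_GquoS] peels off the last: this recurrence yields the
    factorization, the other one the control of consecutive coefficients. *)
Lemma phi_coef_Gquo (R : realType) (k : nat) (phi : R) (j : nat) : phi != 0 ->
  (j < k)%N -> phi * (Gquo k phi)`_j = 1 + (Gquo k phi)`_j.+1.
Proof.
move=> phi_neq0 lt_jk; rewrite !coef_Gquo subnS prednK ?subn_gt0 //.
rewrite big_nat_recl ?subn_gt0 // mulrDr divff //; congr (_ + _).
rewrite mulr_sumr; apply: eq_bigr => i _.
by rewrite exprS invfM mulVKf.
Qed.

Lemma Gpoly_factor (R : realType) (k : nat) (phi : R) : phi != 0 ->
  \sum_(1 <= a < k.+1) phi ^- a = 1 ->
  1 - Gpoly R k = (1 - phi *: 'X) * Gquo k phi.
Proof.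
move=> phi_neq0 phi_root; apply/polyP => n.
rewrite coefB coef1 coef_Gpoly mulrBl mul1r -scalerAl coefB coefZ coefXM.
case: n => [|n] /=; first by rewrite coef_Gquo subn0 phi_root mulr0.
have [lt_nk|le_kn] := ltnP n k; first
  by rewrite phi_coef_Gquo //= sub0r opprD addrCA subrr addr0.
by rewrite !coef_Gquo !(eqP (leq_trans le_kn _)) // !big_geq // mulr0.
Qed.

Lemma phi_ge1 (R : realType) (k : nat) (phi : R) : (0 < k)%N -> 0 < phi ->
  \sum_(1 <= a < k.+1) phi ^- a = 1 -> 1 <= phi.
Proof.
move=> k_gt0 phi_gt0 phi_root; rewrite -invf_le1 //.
rewrite -phi_root big_ltn ?ltnS // lerDl sumr_ge0 // => i _.
by rewrite invr_ge0 exprn_ge0 ?ltW.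
Qed.

Lemma expfV_phi_le1 (R : realType) (k : nat) (phi : R) : (0 < k)%N -> 0 < phi ->
  \sum_(1 <= a < k.+1) phi ^- a = 1 -> phi ^- k <= 1.
Proof.
move=> k_gt0 phi_gt0 phi_root.
by rewrite invf_le1 ?exprn_gt0 // exprn_ege1 // (phi_ge1 k_gt0).
Qed.

Lemma coef_Gquo_ge0 (R : realType) (k : nat) (phi : R) (j : nat) :
  0 < phi -> 0 <= (Gquo k phi)`_j.
Proof.
move=> phi_gt0; rewrite coef_Gquo sumr_ge0 // => i _.
by rewrite invr_ge0 exprn_ge0 ?ltW.
Qed.

Lemma coef0_Gquo (R : realType) (k : nat) (phi : R) :
  \sum_(1 <= a < k.+1) phi ^- a = 1 -> (Gquo k phi)`_0 = 1.
Proof. by rewrite coef_Gquo subn0. Qed.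

Lemma coef_Gquo_le1 (R : realType) (k : nat) (phi : R) (j : nat) : 0 < phi ->
  \sum_(1 <= a < k.+1) phi ^- a = 1 -> (Gquo k phi)`_j <= 1.
Proof.
move=> phi_gt0 phi_root; elim: j => [|j]; first by rewrite coef0_Gquo.
have [lt_jk|le_kj _] := ltnP j k.
  apply: le_trans; rewrite (coef_GquoS phi lt_jk) lerDl.
  by rewrite invr_ge0 exprn_ge0 ?ltW.
by rewrite coef_Gquo (eqP (leq_trans le_kj _)) // big_geq.
Qed.

(* [1 - phi^-k] bounds every ratio of consecutive coefficients of [Gquo], which
   is what makes [renewal] nonnegative. *)
Definition renewal (R : realType) (k : nat) (phi : R) : {poly R} :=
  1 - (1 - (1 - phi ^- k) *: 'X) * Gquo k phi.

Lemma coef0_renewal (R : realType) (k : nat) (phi : R) :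
  \sum_(1 <= a < k.+1) phi ^- a = 1 -> (renewal k phi)`_0 = 0.
Proof.
move=> phi_root; rewrite /renewal mulrBl mul1r -scalerAl !coefB coefZ coefXM.
by rewrite coef1 coef0_Gquo //= mulr0 subr0 subrr.
Qed.

(** With [q_j] the coefficients of [Gquo] and [x = phi^-k], the coefficient at [j + 1 <= k] is [(1 -
    x) q_j - q_(j+1) = phi^-(k-j) - x q_j]. It is nonnegative since [q_j <= 1] and [phi >= 1]. *)
Lemma coef_renewal_ge0 (R : realType) (k : nat) (phi : R) (j : nat) :
  (0 < k)%N -> 0 < phi -> \sum_(1 <= a < k.+1) phi ^- a = 1 ->
  0 <= (renewal k phi)`_j.
Proof.
move=> k_gt0 phi_gt0 phi_root; case: j => [|j]; first by rewrite coef0_renewal.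
rewrite /renewal mulrBl mul1r -scalerAl !coefB coefZ coefXM coef1 /= sub0r opprB.
have [lt_jk|le_kj] := ltnP j k; last first.
  by rewrite !coef_Gquo !(eqP (leq_trans le_kj _)) // !big_geq // mulr0 subrr.
have le_pow : phi ^- k <= phi ^- (k - j).
  rewrite lef_pV2 ?posrE ?exprn_gt0 //.
  by apply: ler_weXn2l; [exact: (phi_ge1 k_gt0)|exact: leq_subr].
have pow_ge0 : 0 <= phi ^- k by rewrite invr_ge0 exprn_ge0 ?ltW.
have := coef_Gquo_le1 j phi_gt0 phi_root.
rewrite (coef_GquoS phi lt_jk) subr_ge0; move: pow_ge0 le_pow.
set x := phi ^- k; set y := phi ^- (k - j); set q := (Gquo k phi)`_j.+1 => *.
nra.
Qed.

(** The point [A = 1 - phi^-k / 2] lies midway between [theta = 1 - phi^-k] and 1, hence is positive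
    even for [theta = 0]. Both factors of [1 - V(1/A) = (1 - theta/A) Q(1/A)] are positive, the
    second being at least its constant term 1. *)
Lemma horner_renewal_lt1 (R : realType) (k : nat) (phi : R) :
  (0 < k)%N -> 0 < phi -> \sum_(1 <= a < k.+1) phi ^- a = 1 ->
  (renewal k phi).[(1 - phi ^- k / 2)^-1] < 1.
Proof.
move=> k_gt0 phi_gt0 phi_root.
have x_gt0 : 0 < phi ^- k by rewrite invr_gt0 exprn_gt0.
have x_le1 := expfV_phi_le1 k_gt0 phi_gt0 phi_root.
have A_gt0 : 0 < 1 - phi ^- k / 2 by lra.
rewrite /renewal !hornerE gtrBl mulr_gt0 //.
  by rewrite subr_gt0 ltr_pdivrMr // mul1r; lra.
apply: lt_le_trans (coef_le_horner 0 (fun j => coef_Gquo_ge0 k j phi_gt0) _).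
  by rewrite coef0_Gquo // mulr1.
by rewrite invr_ge0 ltW.
Qed.

(** * Splitting off the double pole at [sigma] *)

Lemma double_root_factor (R : fieldType) (p : {poly R}) (c : R) :
  p.[c] = 0 -> p^`().[c] = 0 -> exists q, p = ('X - c%:P) ^+ 2 * q.
Proof.
move=> /eqP/factor_theorem[r ->] /eqP.
rewrite derivM derivXsubC !hornerE /= subrr mulr0 add0r.
by move=> /factor_theorem[q ->]; exists q; ring.
Qed.

(** This is [G / (1 - G)^2 = alpha / (1 - phi X)^2 + beta / (1 - phi X) + S / Q^2] with denominators
    cleared. *)
Lemma Gpoly_partial_fraction (R : realType) (k : nat) (phi : R) :
  0 < phi -> \sum_(1 <= a < k.+1) phi ^- a = 1 ->
  let G' := (Gpoly R k)^`() in let G'' := G'^`() in let sigma := phi^-1 in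
  exists S : {poly R}, Gpoly R k =
    (phi ^+ 2 / G'.[sigma] ^+ 2)%:P * Gquo k phi ^+ 2 +
    (phi * G''.[sigma] / G'.[sigma] ^+ 3 - phi / G'.[sigma])%:P
      * (1 - phi *: 'X) * Gquo k phi ^+ 2 + (1 - phi *: 'X) ^+ 2 * S.
Proof.
move=> phi_gt0 phi_root G' G'' sigma.
have phi_neq0 : phi != 0 by rewrite gt_eqF.
have phiV : phi * sigma = 1 by rewrite divff.
set Q := Gquo k phi; set q := Q.[sigma]; set q' := Q^`().[sigma].
have q_neq0 : q != 0.
  rewrite gt_eqF //; apply: lt_le_trans (coef_le_horner 0 _ _).
  - by rewrite coef0_Gquo // mulr1.
  - by move=> j; exact: coef_Gquo_ge0.
  - by rewrite invr_ge0 ltW.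
have GE : Gpoly R k = 1 - (1 - phi *: 'X) * Q by rewrite -Gpoly_factor //; ring.
have G'E : G'.[sigma] = phi * q.
  rewrite /G' GE !derivE !hornerE /= -/q phiV; ring.
have G''E : G''.[sigma] = 2 * phi * q'.
  rewrite /G'' /G' GE !derivE !hornerE /= -/q' phiV; ring.
set alpha := phi ^+ 2 / _; set beta := _ - phi / _.
(* The values of [alpha] and [beta] are those making [D] vanish to second order at [sigma]. *)
pose D := Gpoly R k - alpha%:P * Q ^+ 2 - beta%:P * (1 - phi *: 'X) * Q ^+ 2.
have D0 : D.[sigma] = 0.
  rewrite /D GE !hornerE /= -/q phiV /alpha G'E.
  field; rewrite q_neq0; exact: phi_neq0.
have D'0 : D^`().[sigma] = 0.
  rewrite /D !derivE !hornerE /= -/G' -/q -/q' phiV /alpha /beta G'E G''E.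
  field; rewrite q_neq0; exact: phi_neq0.
have [S DE] := double_root_factor D0 D'0.
(* The factor [sigma^2] comes from [X - sigma = - sigma (1 - phi X)], squared. *)
exists ((sigma ^+ 2)%:P * S).
have XE : 'X - sigma%:P = - sigma%:P * (1 - phi *: 'X).
  rewrite mulrBr mulr1 mulNr opprK -mul_polyC mulrA -polyCM mulrC.
  by rewrite [sigma * _]mulrC phiV; ring.
transitivity (D + alpha%:P * Q ^+ 2 + beta%:P * (1 - phi *: 'X) * Q ^+ 2).
  by rewrite /D; ring.
rewrite DE XE rmorphXn /=; ring.
Qed.

(** * Congruences modulo ['X^N] and the asymptotic formula *)

Lemma dvdXn_total_parts (R : realType) (k N : nat) :
  'X^N %| (1 - Gpoly R k) ^+ 2 * (\poly_(i < N) (total_parts k i)%:R)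
          - Gpoly R k.
Proof.
set G := Gpoly R k; set T := \poly_(_ < _) _.
(* Up to [m = N], so that dropping the zero term [m = 0] leaves [G] times the [N] terms of
   [sqr_geometric_sum]. *)
pose Z := \sum_(m < N.+1) m%:R * G ^+ m.
have ZE : (1 - G) ^+ 2 * Z = G * (1 - N.+1%:R * G ^+ N + N%:R * G ^+ N.+1).
  rewrite -sqr_geometric_sum mulrCA; congr (_ * _).
  rewrite /Z big_ord_recl mul0r add0r mulr_sumr; apply: eq_bigr => m _.
  by rewrite exprS mulrCA.
have XG : 'X^N %| G ^+ N.
  apply: dvdp_exp2r; rewrite -['X]expr1; apply: dvdXn_of_coef => -[] // _.
  by rewrite coef_Gpoly.
have XZ : 'X^N %| T - Z.
  apply: dvdXn_of_coef => i lt_iN; rewrite coefB coef_poly lt_iN.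
  by rewrite (total_parts_Gpoly R k (ltnW lt_iN : (i < N.+1)%N)) subrr.
have -> : (1 - G) ^+ 2 * T - G =
    (1 - G) ^+ 2 * (T - Z) + G ^+ N * (G * (N%:R * G - N.+1%:R)).
  rewrite mulrBr ZE [G ^+ N.+1]exprS; ring.
by apply: dvdp_add; [exact: dvdp_mull|exact: dvdp_mulr].
Qed.

(** Both fractions expand geometrically in [y = phi X], with truncation errors divisible by
    [y^N]. *)
Lemma dvdXn_double_pole (R : fieldType) (phi alpha beta : R) (N : nat) :
  'X^N %| (1 - phi *: 'X) ^+ 2 *
            (\poly_(i < N) (alpha * i.+1%:R * phi ^+ i + beta * phi ^+ i))
          - (alpha%:P + beta%:P * (1 - phi *: 'X)).
Proof.
set y := phi *: 'X.
have -> : \poly_(i < N) (alpha * i.+1%:R * phi ^+ i + beta * phi ^+ i) =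
    alpha%:P * (\sum_(i < N) i.+1%:R * y ^+ i) +
    beta%:P * (\sum_(i < N) y ^+ i).
  rewrite poly_def !mulr_sumr -big_split; apply: eq_bigr => i _ /=.
  rewrite exprZn -!mul_polyC !(polyCD, polyCM) polyC_natr; ring.
have Xy : 'X^N %| y ^+ N by rewrite exprZn -mul_polyC dvdp_mull.
have geom : (1 - y) * (\sum_(i < N) y ^+ i) = 1 - y ^+ N.
  by rewrite -[1 - y]opprB mulNr -subrX1 opprB.
set g1 := \sum_(_ < _) _ in geom *; set g2 := \sum_(_ < _) _ * _.
have g2E : (1 - y) ^+ 2 * g2 = _ := sqr_geometric_sum y N.
have -> : (1 - y) ^+ 2 * (alpha%:P * g2 + beta%:P * g1)
      - (alpha%:P + beta%:P * (1 - y)) =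
    y ^+ N * (alpha%:P * (N%:R * y - N.+1%:R) - beta%:P * (1 - y)).
  transitivity (alpha%:P * ((1 - y) ^+ 2 * g2)
      + beta%:P * (1 - y) * ((1 - y) * g1) - (alpha%:P + beta%:P * (1 - y))).
    ring.
  rewrite g2E geom [y ^+ N.+1]exprS; ring.
exact: dvdp_mulr.
Qed.

Theorem theorem4p6 (R : realType) (k : nat) (k_gt0 : (0 < k)%N)
    (phi : R) (phi_gt0 : 0 < phi)
    (phi_root : \sum_(1 <= a < k.+1) phi ^- a = 1) :
  let sigma := phi^-1 in
  let G := Gpoly R k in
  let G' := G^`() in
  let G'' := G'^`() in
  exists A : R, [/\ 0 < A, A < 1 &
    eq_upto_bigO_exp
      (fun n => (total_parts k n)%:R)
      (fun n => phi ^+ (n + 2) / G'.[sigma] ^+ 2 * (n + 1)%:R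
                + phi ^+ (n + 1) * G''.[sigma] / G'.[sigma] ^+ 3
                - phi ^+ (n + 1) / G'.[sigma])
      A].
Proof.
move=> sigma G G' G''.
have phi_neq0 : phi != 0 by rewrite gt_eqF.
have x_gt0 : 0 < phi ^- k by rewrite invr_gt0 exprn_gt0.
have x_le1 := expfV_phi_le1 k_gt0 phi_gt0 phi_root.
pose A := 1 - phi ^- k / 2; have A_gt0 : 0 < A by rewrite /A; lra.
exists A; split=> //; first by rewrite /A; lra.
have [S GE] := Gpoly_partial_fraction phi_gt0 phi_root.
move: GE; rewrite -/sigma -/G -/G' -/G''.
set alpha := phi ^+ 2 / _; set beta := _ - phi / _; set Q := Gquo k phi => GE.
have FE : 1 - G = (1 - phi *: 'X) * Q by exact: Gpoly_factor.
(* As [c Q = 1 - renewal], the remainder [S / Q^2] equals [c^2 S / (1 - renewal)^2], the form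
   bounded by [coef_decay]. *)
pose c : {poly R} := 1 - (1 - phi ^- k) *: 'X.
have [C C_gt0 decay] := coef_decay (c ^+ 2 * S)
  (fun j => coef_renewal_ge0 j k_gt0 phi_gt0 phi_root) (coef0_renewal phi_root)
  A_gt0 (horner_renewal_lt1 k_gt0 phi_gt0 phi_root).
exists C, 1%N; split=> // n _.
pose T := \poly_(i < n.+1) (total_parts k i)%:R : {poly R}.
pose H := \poly_(i < n.+1) (alpha * i.+1%:R * phi ^+ i + beta * phi ^+ i).
have -> : (total_parts k n)%:R - (phi ^+ (n + 2) / G'.[sigma] ^+ 2 * (n + 1)%:R
    + phi ^+ (n + 1) * G''.[sigma] / G'.[sigma] ^+ 3
    - phi ^+ (n + 1) / G'.[sigma]) = (T - H)`_n.
  rewrite coefB !coef_poly ltnSn /alpha /beta !exprD addn1 expr1; ring.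
apply: (decay n.+1) => //; rewrite /renewal subKr.
have XE : 'X^(n.+1) %| (1 - phi *: 'X) ^+ 2 * (Q ^+ 2 * (T - H) - S).
  have -> : (1 - phi *: 'X) ^+ 2 * (Q ^+ 2 * (T - H) - S) =
      ((1 - G) ^+ 2 * T - G) - Q ^+ 2 *
      ((1 - phi *: 'X) ^+ 2 * H - (alpha%:P + beta%:P * (1 - phi *: 'X))).
    by rewrite FE [X in _ - X - _]GE; ring.
  apply: dvdp_sub; first exact: dvdXn_total_parts.
  by apply: dvdp_mull; exact: dvdXn_double_pole.
(* The factor [(1 - phi X)^2] cancels: its constant term is 1, so it is coprime to ['X^(n+1)]. *)
rewrite Gauss_dvdpr in XE; last first.
  apply: coprimep_expl; apply: coprimep_expr.
  by rewrite coprimep_sym coprimepX rootE !hornerE subr0 oner_eq0.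
rewrite -/Q -/c.
have -> : (c * Q) ^+ 2 * (T - H) - c ^+ 2 * S = c ^+ 2 * (Q ^+ 2 * (T - H) - S).
  by ring.
exact: dvdp_mull.
Qed.
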